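(* Let $\mathcal{H}$ be a finite-dimensional complex Hilbert space and let $\rho,\sigma$ be density operators on $\mathcal{H}$ with $\sigma$ invertible. Then $$\sup_{\vec M}\underline{D}^{\vec M}(\vec\rho\|\vec\sigma)=\sup_{\vec M}\overline{D}^{\vec M}(\vec\rho\|\vec\sigma)=D(\rho\|\sigma),$$ where both suprema are over all sequences $\vec M=\{M^n\}_{n=1}^\infty$ with $M^n$ a POVM on $\mathcal{H}^{\otimes n}$.
   Context: A density operator is a positive semidefinite operator of trace one. $\rho^{\otimes n}$ is the $n$-fold tensor power of $\rho$ acting on $\mathcal{H}^{\otimes n}$. $D(\rho\|\sigma)=\operatorname{Tr}\rho(\log\rho-\log\sigma)$ (natural logarithm, $0\log0=0$). A POVM on a finite-dimensional Hilbert space is a finite family $M=\{M_i\}$ of positive semidefinite operators with $\sum_iM_i=\mathrm{I}$; measuring a state $\rho$ with it gives the probability distribution $\mathrm{P}^M_\rho(i)=\operatorname{Tr}M_i\rho$. For sequences $\vec p=\{p_n\}$, $\vec q=\{q_n\}$ of probability distributions, with $p_n,q_n$ on the same finite set $\Omega_n$, define $$\underline{D}(\vec p\|\vec q):=\sup\Big\{\lambda\ \Big|\ \lim_{n\to\infty}p_n\big\{\omega_n\ \big|\ \tfrac1n\log\tfrac{p_n(\omega_n)}{q_n(\omega_n)}<\lambda\big\}=0\Big\},$$ $$\overline{D}(\vec p\|\vec q):=\inf\Big\{\lambda\ \Big|\ \lim_{n\to\infty}p_n\big\{\omega_n\ \big|\ \tfrac1n\log\tfrac{p_n(\omega_n)}{q_n(\omega_n)}>\lambda\big\}=0\Big\}.$$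 For a sequence $\vec M=\{M^n\}$ of POVMs, with $M^n$ on $\mathcal{H}^{\otimes n}$, $$\underline{D}^{\vec M}(\vec\rho\|\vec\sigma):=\underline{D}\big(\{\mathrm{P}^{M^n}_{\rho^{\otimes n}}\}\big\|\{\mathrm{P}^{M^n}_{\sigma^{\otimes n}}\}\big),\qquad \overline{D}^{\vec M}(\vec\rho\|\vec\sigma):=\overline{D}\big(\{\mathrm{P}^{M^n}_{\rho^{\otimes n}}\}\big\|\{\mathrm{P}^{M^n}_{\sigma^{\otimes n}}\}\big).$$ *)

(* Defs.v *)
From mathcomp Require Import all_boot all_order all_algebra.
From mathcomp Require Import complex mxtens.
From mathcomp Require Import all_classical all_reals all_analysis.
Set Implicit Arguments.
Unset Strict Implicit.
Unset Printing Implicit Defensive.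
Import Order.TTheory GRing.Theory Num.Theory.
Import numFieldNormedType.Exports.
Local Open Scope classical_set_scope.
Local Open Scope complex_scope.
Local Open Scope sesquilinear_scope.
Local Open Scope ring_scope.

(** A [d]-dimensional complex Hilbert space is [C^d], with [C = R[i]];
    operators are square matrices, and [ntensmx A n : 'M_(d ^ n)] is the [n]-fold
    Kronecker power of [A]. *)

Definition psdmx (R : realType) (d : nat) (A : 'M[R[i]]_d) : Prop :=
  A \is hermsymmx /\ forall x : 'cV[R[i]]_d, 0 <= (x ^t* *m A *m x) 0 0.

Definition density (R : realType) (d : nat) (A : 'M[R[i]]_d) : Prop :=
  psdmx A /\ \tr A = 1.

(** Functional calculus for a Hermitian matrix [A], from its spectral
    decomposition [A = invmx P *m diag_mx D *m P] with [P] unitary, [D] real. *)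
Definition hermfun (R : realType) (d : nat) (f : R -> R) (A : 'M[R[i]]_d) :
    'M[R[i]]_d :=
  let P := spectralmx A in
  let D := spectral_diag A in
  invmx P *m diag_mx (map_mx (fun z : R[i] => (f (complex.Re z))%:C) D) *m P.

Definition logmx (R : realType) (d : nat) (A : 'M[R[i]]_d) : 'M[R[i]]_d :=
  hermfun (@ln R) A.

(** As [ln 0 = 0], the product [rho *m logmx rho] obeys [0 log 0 = 0].  The trace
    is a real number; this is the relative entropy when [sigma] is invertible. *)
Definition qrelent (R : realType) (d : nat) (rho sigma : 'M[R[i]]_d) : R :=
  complex.Re (\tr (rho *m (logmx rho - logmx sigma))).

(** A finite family of operators is indexed by ['I_k].  Quantifying over an
    arbitrary [finType] of outcomes instead would put [povm] in too large a universe
    for [set (povm_seq R d)] to be well-typed. *)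
Record povm (R : realType) (d : nat) := Povm {
  outcomes : nat;
  povm_op : 'I_outcomes -> 'M[R[i]]_d;
  povm_psd : forall k, psdmx (povm_op k);
  povm_sum : \sum_k povm_op k = 1%:M }.

(** [Tr (M_k rho)] is real for a positive semidefinite [rho]. *)
Definition povm_prob (R : realType) (d : nat) (M : povm R d)
    (rho : 'M[R[i]]_d) (k : 'I_(outcomes M)) : R :=
  complex.Re (\tr (povm_op k *m rho)).

(** Sequences start at index 1 in the mathematics: [p n], [q n] and [Omega n]
    below are the objects at block length [n.+1].  In [\bar R] the conventions
    [0^-1 = +oo], [0 * +oo = 0] and [lne 0 = -oo] make the log-likelihood ratio
    [+oo] where [p > 0 = q] and [-oo] where [p = 0]. *)
Definition llr (R : realType) (Omega : nat -> finType)
    (p q : forall n, Omega n -> R) (n : nat) (w : Omega n) : \bar R :=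
  ((n.+1%:R^-1)%:E * lne ((p n w)%:E / (q n w)%:E))%E.

Definition inf_div_rate (R : realType) (Omega : nat -> finType)
    (p q : forall n, Omega n -> R) : \bar R :=
  ereal_sup [set l%:E | l in [set l : R |
    (fun n => \sum_(w : Omega n | (llr p q w < l%:E)%E) p n w) @ \oo --> (0 : R)]].

Definition sup_div_rate (R : realType) (Omega : nat -> finType)
    (p q : forall n, Omega n -> R) : \bar R :=
  ereal_inf [set l%:E | l in [set l : R |
    (fun n => \sum_(w : Omega n | (llr p q w > l%:E)%E) p n w) @ \oo --> (0 : R)]].

(** [M n] is the measurement on the [n.+1]-fold tensor power. *)
Definition povm_seq (R : realType) (d : nat) : Type :=
  forall n : nat, povm R (d ^ n.+1)%N.

Definition povm_inf_div_rate (R : realType) (d : nat) (rho sigma : 'M[R[i]]_d)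
    (M : povm_seq R d) : \bar R :=
  inf_div_rate (fun n => @povm_prob R _ (M n) (ntensmx rho n.+1))
               (fun n => @povm_prob R _ (M n) (ntensmx sigma n.+1)).

Definition povm_sup_div_rate (R : realType) (d : nat) (rho sigma : 'M[R[i]]_d)
    (M : povm_seq R d) : \bar R :=
  sup_div_rate (fun n => @povm_prob R _ (M n) (ntensmx rho n.+1))
               (fun n => @povm_prob R _ (M n) (ntensmx sigma n.+1)).

(* Main.v *)
Require Import Defs.
From HB Require Import structures.
From mathcomp Require Import all_boot all_order all_algebra.
From mathcomp Require Import complex mxtens ring lra.
From mathcomp Require Import all_classical all_reals all_analysis.
Set Implicit Arguments.
Unset Strict Implicit.
Unset Printing Implicit Defensive.
Import Order.TTheory GRing.Theory Num.Theory.
Import numFieldNormedType.Exports.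
Local Open Scope classical_set_scope.
Local Open Scope complex_scope.
Local Open Scope sesquilinear_scope.
Local Open Scope ring_scope.

(** Diagonalize [rho = P^* diag(p) P] and [sigma = Q^* diag(s) Q], and let
    [w j = <f_j, rho f_j>] for the eigenvectors [f_j] of [sigma], so that
    [D = sum p ln p - sum w ln s].  On the [n]-fold tensor power let [A] be the
    set of eigenvectors [e_i] of [rho] with eigenvalue
    [exp (n (sum p ln p +- dl))], and let [F] be the projector on the eigenvectors of [sigma] with eigenvalue
    [exp (n (sum w ln s +- dl))].  By Chebyshev's inequality the complements of
    [A] and of [F] have vanishing [rho]-probability.

    Upper bound: for a test [0 <= T <= 1], the parallelogram law for the
    semi-norm [v T v^*] splits [e_i] into [e_i F + e_i (1 - F)], which gives
    [tr (rho T) <= o(1) + 2 exp (n (D + 2 dl)) tr (sigma T)].  Apply this to the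
    sum of the POVM elements whose log-likelihood ratio exceeds [D + eps], for
    which [tr (sigma T) <= exp (- n (D + eps))].

    Lower bound: the projector [T] on the span of the [e_i F], [i] in [A], has
    rank at most [#|A|] and lies below [F], hence
    [tr (sigma T) <= exp (- n (D - 2 dl))], while
    [tr (rho T) >= tr (rho F) - o(1)].  Measure [{T, 1 - T}]. *)

(** * Typical eigenvalues of tensor powers *)

Section TensorPowerWeights.
Variables (R : realType) (d : nat).
Implicit Types u w r g : 'I_d -> R.

(** The recursion follows that of [ntensmx] on [n.+1] factors, so this is the diagonal of the
    Kronecker power of [diag(u)]; when [u] is a probability vector, it is the product
    distribution. *)
Fixpoint tens_prod u n : 'I_(d ^ n.+1) -> R :=
  if n is n'.+1 return 'I_(d ^ n.+1) -> R then
    fun k => u (mxtens_unindex k).1 * tens_prod u (mxtens_unindex k).2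
  else u.

Fixpoint tens_sum g n : 'I_(d ^ n.+1) -> R :=
  if n is n'.+1 return 'I_(d ^ n.+1) -> R then
    fun k => g (mxtens_unindex k).1 + tens_sum g (mxtens_unindex k).2
  else g.

Lemma sum_mxtens m n (F : 'I_m * 'I_n -> R) :
  \sum_(k < m * n) F (mxtens_unindex k) = \sum_i \sum_j F (i, j).
Proof.
rewrite pair_big /=; symmetry.
rewrite (reindex (@mxtens_unindex m n)) /=; last first.
  by exists (@mxtens_index m n) => i; rewrite (mxtens_indexK, mxtens_unindexK).
by apply: eq_bigr => k _; congr F; rewrite -surjective_pairing.
Qed.

Lemma tens_prod_ge0 u n (k : 'I_(d ^ n.+1)) :
  (forall i, 0 <= u i) -> 0 <= tens_prod u k.
Proof. by move=> u0; elim: n k => [|n IH] k //=; rewrite mulr_ge0. Qed.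

Lemma sum_tens_prod u n :
  \sum_(k < d ^ n.+1) tens_prod u k = (\sum_i u i) ^+ n.+1.
Proof.
elim: n => [|n IH]; first by rewrite expr1.
rewrite exprS -IH (@sum_mxtens d (d ^ n.+1) (fun p => u p.1 * tens_prod u p.2)) /=.
by rewrite mulr_suml; apply: eq_bigr => i _; rewrite mulr_sumr.
Qed.

(** * Moments of a sum of independent centred variables *)

Section SecondMoment.
Variables w g : 'I_d -> R.
Hypotheses (w1 : \sum_i w i = 1) (wg0 : \sum_i w i * g i = 0).

Lemma sum_tens_prod_sum n : \sum_(k < d ^ n.+1) tens_prod w k * tens_sum g k = 0.
Proof.
elim: n => [|n IH] //.
rewrite (@sum_mxtens d (d ^ n.+1)
  (fun p => w p.1 * tens_prod w p.2 * (g p.1 + tens_sum g p.2))) /=.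
have E (i : 'I_d) (k : 'I_(d ^ n.+1)) : w i * tens_prod w k * (g i + tens_sum g k) =
    w i * g i * tens_prod w k + w i * (tens_prod w k * tens_sum g k) by ring.
under eq_bigr => i _.
  under eq_bigr do rewrite E.
  rewrite big_split /= -!mulr_sumr sum_tens_prod w1 expr1n mulr1 IH mulr0 addr0.
  over.
by rewrite wg0.
Qed.

(** Additivity of the variance: the cross term carries the first moment of [tens_sum g], which
    vanishes by [sum_tens_prod_sum]. *)
Lemma sum_tens_prod_sqr n :
  \sum_(k < d ^ n.+1) tens_prod w k * tens_sum g k ^+ 2 =
  n.+1%:R * \sum_i w i * g i ^+ 2.
Proof.
elim: n => [|n IH]; first by rewrite mul1r.
rewrite (@sum_mxtens d (d ^ n.+1)
  (fun p => w p.1 * tens_prod w p.2 * (g p.1 + tens_sum g p.2) ^+ 2)) /=.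
have E (i : 'I_d) (k : 'I_(d ^ n.+1)) :
    w i * tens_prod w k * (g i + tens_sum g k) ^+ 2 =
    w i * g i ^+ 2 * tens_prod w k
    + w i * g i * 2 * (tens_prod w k * tens_sum g k)
    + w i * (tens_prod w k * tens_sum g k ^+ 2) by ring.
under eq_bigr => i _.
  under eq_bigr do rewrite E.
  rewrite !big_split /= -!mulr_sumr sum_tens_prod w1 expr1n mulr1.
  rewrite sum_tens_prod_sum mulr0 addr0 IH.
  over.
by rewrite big_split /= -mulr_suml w1 mul1r [in RHS]mulrSr mulrDl mul1r addrC.
Qed.

End SecondMoment.

Definition typical r (m dl : R) n (k : 'I_(d ^ n.+1)) : bool :=
  expR (n.+1%:R * (m - dl)) <= tens_prod r k <= expR (n.+1%:R * (m + dl)).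

(** A positive product of [w] forces each factor, and hence each [r i] involved, to be positive;
    there [expR] inverts [ln], which it would not do at the default value [ln 0 = 0]. *)
Lemma tens_prod_expR w r m n (k : 'I_(d ^ n.+1)) :
  (forall i, 0 <= w i) -> (forall i, 0 < w i -> 0 < r i) ->
  0 < tens_prod w k ->
  tens_prod r k = expR (n.+1%:R * m + tens_sum (fun i => ln (r i) - m) k).
Proof.
move=> w0 wr; elim: n k => [|n IH] k /=.
  by move=> wk; rewrite mul1r addrC subrK lnK // posrE wr.
move=> wk.
have w1 : 0 < w (mxtens_unindex k).1.
  by rewrite lt_neqAle w0 andbT; apply: contraTneq wk => <-; rewrite mul0r ltxx.
rewrite (IH (mxtens_unindex k).2); last by move: wk; rewrite pmulr_rgt0.
rewrite -{1}(@lnK _ (r _)); last by rewrite posrE wr.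
rewrite -expRD; congr expR; rewrite [in RHS]mulrSr; ring.
Qed.

(** Chebyshev's inequality: off the typical set [tens_sum g] has modulus at least [n.+1 * dl], so
    each weight is at most its share of the second moment divided by the square of that
    threshold. *)
Lemma typical_set_tail w r (m dl : R) n :
  (forall i, 0 <= w i) -> \sum_i w i = 1 -> (forall i, 0 < w i -> 0 < r i) ->
  m = \sum_i w i * ln (r i) -> 0 < dl ->
  \sum_(k | ~~ @typical r m dl n k) tens_prod w k <=
  (\sum_i w i * (ln (r i) - m) ^+ 2) / dl ^+ 2 / n.+1%:R.
Proof.
move=> w0 w1 wr mE dl0.
set g := fun i => ln (r i) - m.
have wg0 : \sum_i w i * g i = 0.
  under eq_bigr do rewrite mulrBr.
  by rewrite sumrB -mulr_suml w1 mul1r -mE subrr.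
have n0 : 0 < n.+1%:R :> R by rewrite ltr0n.
have nd0 : 0 < n.+1%:R * dl by rewrite mulr_gt0.
have -> : (\sum_i w i * g i ^+ 2) / dl ^+ 2 / n.+1%:R =
    (\sum_(k < d ^ n.+1) tens_prod w k * tens_sum g k ^+ 2) / (n.+1%:R * dl) ^+ 2.
  rewrite sum_tens_prod_sqr //; field.
  by rewrite !lt0r_neq0.
rewrite mulr_suml big_mkcond /=; apply: ler_sum => k _.
have wk0 := @tens_prod_ge0 w n k w0.
case: ifP => [|_]; last first.
  by apply: divr_ge0; [apply: mulr_ge0 => // |]; exact: sqr_ge0.
(* The exponential formula for [tens_prod r k] is available only at positive weight; null indices
   contribute nothing. *)
case: (ltP 0 (tens_prod w k)) => [wk|wk]; last first.
  have -> : tens_prod w k = 0 by apply/eqP; rewrite eq_le wk wk0.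
  by rewrite !mul0r.
rewrite /typical (tens_prod_expR m w0 wr wk) !ler_expR -/g => H.
rewrite -mulrA ler_pMr // ler_pdivlMr ?exprn_gt0 // mul1r.
rewrite -[leRHS]real_normK ?num_real //.
rewrite ler_pXn2r ?nnegrE ?normr_ge0 // ?(ltW nd0) //.
rewrite leNgt; apply: contra H; rewrite ltr_norml => /andP[h1 h2].
by apply/andP; split; rewrite ?mulrBr ?mulrDr lerD2l ltW.
Qed.

Lemma typical_set_cvg w r (m dl : R) :
  (forall i, 0 <= w i) -> \sum_i w i = 1 -> (forall i, 0 < w i -> 0 < r i) ->
  m = \sum_i w i * ln (r i) -> 0 < dl ->
  (fun n => \sum_(k | ~~ @typical r m dl n k) tens_prod w k) @ \oo --> (0 : R).
Proof.
move=> w0 w1 wr mE dl0.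
apply: (@squeeze_cvgr _ _ _ _ (fun=> 0)
  (fun n => (\sum_i w i * (ln (r i) - m) ^+ 2) / dl ^+ 2 * harmonic n)).
- near=> n; rewrite typical_set_tail // andbT.
  by apply: sumr_ge0 => k _; apply: tens_prod_ge0.
- exact: cvg_cst.
- rewrite -[X in _ --> X](mulr0 ((\sum_i w i * (ln (r i) - m) ^+ 2) / dl ^+ 2)).
  by apply: cvgM; [exact: cvg_cst | exact: cvg_harmonic].
Unshelve. all: by end_near.
Qed.

(** Each typical index has weight at least [expR (n.+1 * (m - dl))], and the total weight is 1. *)
Lemma card_typical w m dl n :
  (forall i, 0 <= w i) -> \sum_i w i = 1 ->
  #|[pred k | @typical w m dl n k]|%:R <= expR (- (n.+1%:R * (m - dl))).
Proof.
move=> w0 w1.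
rewrite expRN -[leRHS]mul1r ler_pdivlMr ?expR_gt0 //.
have e : \sum_(k < d ^ n.+1) tens_prod w k = 1.
  by rewrite sum_tens_prod w1 expr1n.
rewrite -[leRHS]e -sum1_card natr_sum mulr_suml.
rewrite [leRHS](bigID (@typical w m dl n)) /=.
apply: ler_wpDr; first by apply: sumr_ge0 => k _; apply: tens_prod_ge0.
by apply: ler_sum => k /andP[h _]; rewrite mul1r.
Qed.

End TensorPowerWeights.

(** * Tests between two spectral decompositions *)

(** Locked because unification over [R[i]] is slow when it unfolds products. *)
HB.lock Definition spectral_mx (R : realType) N (P : 'M[R[i]]_N) (p : 'I_N -> R)
  : 'M[R[i]]_N := P^t* *m diag_mx (\row_i (p i)%:C) *m P.

Lemma parallelogram_mx (K : numClosedFieldType) N (T : 'M[K]_N) (u v : 'rV_N) :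
  ((u + v) *m T *m (u + v)^t*) 0 0 + ((u - v) *m T *m (u - v)^t*) 0 0 =
  ((u *m T *m u^t*) 0 0 + (v *m T *m v^t*) 0 0) *+ 2.
Proof.
have cD (w : 'rV[K]_N) : (u + w)^t* = u^t* + w^t*.
  by apply/matrixP => i j; rewrite !mxE rmorphD.
have cN : (- v)^t* = - v^t* by apply/matrixP => i j; rewrite !mxE rmorphN.
rewrite !cD cN !mulmxDr !mulmxDl !mulmxN !mulNmx.
have D (X Y : 'M[K]_1) : (X + Y) 0 0 = X 0 0 + Y 0 0 by rewrite mxE.
have O (X : 'M[K]_1) : (- X) 0 0 = - X 0 0 by rewrite mxE.
rewrite !(D, O); ring.
Qed.

Lemma sandwich_mulmx (K : numClosedFieldType) N (P D E : 'M[K]_N) :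
  P \is unitarymx ->
  P^t* *m D *m P *m (P^t* *m E *m P) = P^t* *m (D *m E) *m P.
Proof. by move=> uP; rewrite !mulmxA (mulmxtVK _ uP). Qed.

Section QuadraticForm.
Variable R : realType.
Local Notation C := R[i].

Definition qform N (T : 'M[C]_N) (v : 'rV[C]_N) : R :=
  complex.Re ((v *m T *m v^t*) 0 0).

Lemma trmxC_mul m n p (A : 'M[C]_(m, n)) (B : 'M[C]_(n, p)) :
  (A *m B)^t* = B^t* *m A^t*.
Proof. by rewrite trmx_mul map_mxM. Qed.

Lemma trmxCB m n (A B : 'M[C]_(m, n)) : (A - B)^t* = A^t* - B^t*.
Proof. by apply/matrixP => i j; rewrite !mxE rmorphB. Qed.

Lemma qform_ge0 N (T : 'M[C]_N) v : psdmx T -> 0 <= qform T v.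
Proof.
case=> _ /(_ (v^t*)); rewrite trmxCK /qform.
by case: (_ 0 0) => a b; rewrite lecE /= => /andP[].
Qed.

Lemma qform_addmx N (S T : 'M[C]_N) v : qform (S + T) v = qform S v + qform T v.
Proof. by rewrite /qform mulmxDr mulmxDl mxE raddfD. Qed.

Lemma qform_submx N (S T : 'M[C]_N) v : qform (S - T) v = qform S v - qform T v.
Proof. by rewrite /qform mulmxBr mulmxBl !mxE raddfB. Qed.

(** Drop the nonnegative term at [u - v] from the parallelogram law. The factor 2 is harmless on the
    exponential scale. *)
Lemma qformD_le N (T : 'M[C]_N) u v :
  psdmx T -> qform T (u + v) <= 2 * qform T u + 2 * qform T v.
Proof.
move=> /(@qform_ge0 _ _ (u - v)).
have Re_le (a b c e : C) : a + b = (c + e) *+ 2 -> 0 <= complex.Re b ->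
    complex.Re a <= 2 * complex.Re c + 2 * complex.Re e.
  by move: a b c e => [? ?] [? ?] [? ?] [? ?]; rewrite mulr2n => -[+ _] /=; lra.
exact: Re_le (parallelogram_mx T u v).
Qed.

Lemma qform_mul N (T M : 'M[C]_N) v :
  qform T (v *m M) = qform (M *m T *m M^t*) v.
Proof. by rewrite /qform trmxC_mul !mulmxA. Qed.

Lemma sum_qform_rows m N (T : 'M[C]_N) (A : 'M[C]_(m, N)) :
  \sum_i qform T (row i A) = complex.Re (\tr (A *m T *m A^t*)).
Proof.
rewrite /mxtrace raddf_sum; apply: eq_bigr => i _; rewrite /qform.
congr complex.Re; rewrite -!row_mul !mxE; apply: eq_bigr => j _.
by rewrite !mxE.
Qed.

Lemma sum_qform_unitary N (T P : 'M[C]_N) : P \is unitarymx ->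
  \sum_i qform T (row i P) = complex.Re (\tr T).
Proof.
move=> uP; rewrite sum_qform_rows mxtrace_mulC mulmxA -(invmx_unitary uP).
by rewrite mulVmx ?unitarymx_unit // mul1mx.
Qed.

Lemma trace_spectral N (T P : 'M[C]_N) (p : 'I_N -> R) :
  complex.Re (\tr (T *m spectral_mx P p)) = \sum_i p i * qform T (row i P).
Proof.
rewrite !spectral_mx.unlock mxtrace_mulC -!mulmxA mxtrace_mulC.
rewrite -!mulmxA mul_diag_mx /mxtrace raddf_sum; apply: eq_bigr => i _.
rewrite mulmxA !mxE /qform -row_mul !mxE.
set z := (X in _ * X); set z' := (X in _ = _ * complex.Re X).
have -> : z = z' by apply: eq_bigr => k _; rewrite !mxE.
by case: z' => a b /=; rewrite mul0r subr0.
Qed.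

Lemma spectral_mxM N (P : 'M[C]_N) p q : P \is unitarymx ->
  spectral_mx P p *m spectral_mx P q = spectral_mx P (fun i => p i * q i).
Proof.
move=> uP; rewrite !spectral_mx.unlock (sandwich_mulmx _ _ uP) mulmx_diag.
apply: (congr1 (fun v => P^t* *m diag_mx v *m P)); apply/rowP => i.
by rewrite !mxE rmorphM.
Qed.

Lemma spectral_mx_adj N (P : 'M[C]_N) p : (spectral_mx P p)^t* = spectral_mx P p.
Proof.
rewrite !spectral_mx.unlock !trmxC_mul trmxCK mulmxA; congr (_ *m _ *m _).
rewrite tr_diag_mx map_diag_mx; congr diag_mx.
by apply/rowP => i; rewrite !mxE; exact: conjc_real.
Qed.

Lemma spectral_mx1 N (P : 'M[C]_N) : P \is unitarymx ->
  spectral_mx P (fun=> 1) = 1%:M.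
Proof.
move=> uP; rewrite !spectral_mx.unlock.
have -> : \row_(i < N) (1%:C : C) = const_mx 1 by apply/rowP => i; rewrite !mxE.
by rewrite diag_const_mx mulmx1 -invmx_unitary // mulVmx // unitarymx_unit.
Qed.

Lemma row_mul_spectral N (P : 'M[C]_N) p i : P \is unitarymx ->
  row i P *m spectral_mx P p = (p i)%:C *: row i P.
Proof.
move=> uP; rewrite !spectral_mx.unlock -row_mul !mulmxA (unitarymxP uP) mul1mx.
by rewrite row_mul row_diag_mx mxE -scalemxAl -rowE.
Qed.

Lemma qform1_row N (P : 'M[C]_N) i : P \is unitarymx ->
  qform 1%:M (row i P) = 1.
Proof.
move=> uP; rewrite /qform mulmx1.
have -> : (row i P *m (row i P)^t*) 0 0 = (P *m P^t*) i i.
  by rewrite !mxE; apply: eq_bigr => k _; rewrite !mxE.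
by rewrite (unitarymxP uP) mxE eqxx.
Qed.

(** For such a [T], the form at [x] is the squared norm of [T x]. *)
Lemma adj_proj_psd N (T : 'M[C]_N) : T^t* = T -> T *m T = T -> psdmx T.
Proof.
move=> Ta Ti; split; first by rewrite is_hermitianmxE expr0 scale1r Ta.
move=> x; rewrite -Ti -{1}Ta -!mulmxA mulmxA -trmxC_mul mxE.
apply: sumr_ge0 => i _; by rewrite !mxE mulrC mul_conjC_ge0.
Qed.

Lemma psd_proj_spectral N (P : 'M[C]_N) (A : pred 'I_N) : P \is unitarymx ->
  psdmx (spectral_mx P (fun i => (A i)%:R)).
Proof.
move=> uP; apply: adj_proj_psd; first exact: spectral_mx_adj.
rewrite spectral_mxM //; congr spectral_mx; apply: boolp.funext => i.
by rewrite -natrM mulnb andbb.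
Qed.

(** Gram-Schmidt on a basis of the row space gives a matrix [U] with orthonormal rows; take
    [T = U^* U], whose trace is the rank of [K]. *)
Lemma row_space_projector m N (K : 'M[C]_(m, N)) :
  exists T : 'M[C]_N, [/\ T^t* = T, T *m T = T, (T <= K)%MS, K *m T = K &
    complex.Re (\tr T) <= m%:R].
Proof.
pose U := schmidt (row_base K).
have uU : U \is unitarymx by apply: schmidt_unitarymx; apply: rank_leq_col.
have UK : (U :=: K)%MS.
  apply: eqmx_trans (eq_row_base K); apply: eqmx_schmidt_free.
  exact: row_base_free.
have KU : (K <= U)%MS by rewrite UK.
have U_K : (U <= K)%MS by rewrite UK.
move: U uU KU U_K {UK} => U uU KU U_K; exists (U^t* *m U); split.
- by rewrite trmxC_mul trmxCK.
- by rewrite mulmxA (mulmxtVK _ uU).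
- by rewrite mulmx_sub.
- have /submxP[X KX] := KU.
  have H Z : Z = X *m U -> Z *m (U^t* *m U) = Z.
    by move=> ->; rewrite mulmxA (mulmxtVK _ uU).
  exact: H.
- rewrite mxtrace_mulC (unitarymxP uU) mxtrace1.
  by rewrite -(rmorph_nat (@real_complex R)) /= ler_nat rank_leq_row.
Qed.

(** * Bounds for a single test of [rho] against [sigma] *)

Section Tests.
Variables (N : nat) (P Q : 'M[C]_N) (p s : 'I_N -> R) (A B : pred 'I_N).
Hypotheses (uP : P \is unitarymx) (uQ : Q \is unitarymx).
Hypotheses (p_ge0 : forall i, 0 <= p i) (s_ge0 : forall j, 0 <= s j).

Local Notation rho := (spectral_mx P p).
Local Notation sigma := (spectral_mx Q s).
Local Notation w j := (qform rho (row j Q)).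
Let F := spectral_mx Q (fun j => (B j)%:R).

Let Fadj : F^t* = F. Proof. exact: spectral_mx_adj. Qed.

Let FF : F *m F = F.
Proof.
rewrite spectral_mxM //; congr spectral_mx.
by apply: boolp.funext => i; rewrite -natrM mulnb andbb.
Qed.

Lemma F_sandwich : F *m 1%:M *m F^t* = F.
Proof. by rewrite mulmx1 Fadj FF. Qed.

(** Both sides are the trace of [rho] times a spectral projector of [sigma], expanded in the
    eigenbasis of [rho] and in that of [sigma]. *)
Lemma trace_spectral_proj (X : pred 'I_N) :
  \sum_i p i * qform (spectral_mx Q (fun j => (X j)%:R)) (row i P) =
  \sum_(j | X j) w j.
Proof.
rewrite -trace_spectral mxtrace_mulC trace_spectral [RHS]big_mkcond /=.
by apply: eq_bigr => j _; case: (X j); rewrite ?mul1r ?mul0r.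
Qed.

Lemma spectral_compl : spectral_mx Q (fun j => (~~ B j)%:R) = 1%:M - F.
Proof.
rewrite -(spectral_mx1 uQ) /F !spectral_mx.unlock -mulmxBl -mulmxBr -raddfB /=.
congr (_ *m diag_mx _ *m _); apply/rowP => i; rewrite !mxE.
by case: (B i); rewrite /= ?subrr ?subr0.
Qed.

(** The hypothesis on [B] says [F <= b sigma]. The parts [e_i F] contribute in total at most [a]
    times the trace of [F T F], hence at most [a * b] times that of [T sigma]; the parts
    [e_i (1 - F)] give the [rho]-mass off [B]. *)
Lemma test_converse (T : 'M[C]_N) (a b : R) :
  psdmx T -> psdmx (1%:M - T) -> 0 <= a -> 0 <= b ->
  (forall i, A i -> p i <= a) -> (forall j, B j -> 1 <= b * s j) ->
  complex.Re (\tr (T *m rho)) <=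
  \sum_(i | ~~ A i) p i + 2 * (a * b * complex.Re (\tr (T *m sigma)))
  + 2 * \sum_(j | ~~ B j) w j.
Proof.
move=> T0 T1 a0 b0 pa bs.
have qT1 v : qform T v <= qform 1%:M v.
  by rewrite -subr_ge0 -qform_submx qform_ge0.
rewrite -(trace_spectral_proj (fun j => ~~ B j)) spectral_compl; set F' := 1%:M - F.
have F'a : F' *m 1%:M *m F'^t* = F'.
  rewrite mulmx1 /F' -spectral_compl spectral_mx_adj spectral_mxM //.
  congr spectral_mx.
  by apply: boolp.funext => i; rewrite -natrM mulnb andbb.
(* Outside [A], the bound [T <= 1] at a unit vector leaves [p i]. Inside [A], split the eigenvector
   by [F] and [F'], and use [T <= 1] on the [F'] part only. *)
have step i : p i * qform T (row i P) <=
    (~~ A i)%:R * p i + 2 * (a * qform T (row i P *m F))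
    + 2 * (p i * qform F' (row i P)).
  have F'0 : 0 <= qform F' (row i P).
    by rewrite -F'a -qform_mul; apply: le_trans (qT1 _); apply: qform_ge0.
  have qF0 : 0 <= qform T (row i P *m F) by exact: qform_ge0.
  case Ai: (A i) => /=; last first.
    rewrite mul1r -addrA ler_wpDr //.
      by rewrite addr_ge0 // mulr_ge0 // mulr_ge0.
    by rewrite ler_piMr // (le_trans (qT1 _)) // qform1_row.
  rewrite mul0r add0r.
  have h : qform T (row i P) <= 2 * qform T (row i P *m F) + 2 * qform F' (row i P).
    rewrite -{1}[row i P]mulmx1 -(subrK F 1%:M) mulmxDr addrC.
    apply: le_trans (qformD_le _ _ T0) _; rewrite lerD2l ler_pM2l //.
    by rewrite -F'a -qform_mul qT1.
  have := ler_wpM2l (p_ge0 i) h; rewrite mulrDr.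
  have := ler_wpM2r qF0 (pa i Ai).
  move: (qform T (row i P *m F)) (qform T _) (qform F' _) => x y z; lra.
rewrite trace_spectral; apply: le_trans (ler_sum _ (fun i _ => step i)) _.
rewrite !big_split /= -!mulr_sumr lerD2r.
have -> : \sum_(i | ~~ A i) p i = \sum_i (~~ A i)%:R * p i.
  rewrite big_mkcond /=; apply: eq_bigr => i _.
  by case: (A i); rewrite /= ?mul1r ?mul0r.
rewrite lerD2l ler_pM2l // -mulrA ler_wpM2l //.
under eq_bigr do rewrite qform_mul.
rewrite (sum_qform_unitary _ uP) Fadj mxtrace_mulC (mulmxA F) FF mxtrace_mulC.
rewrite !trace_spectral mulr_sumr; apply: ler_sum => j _.
rewrite mulrA ler_wpM2r ?qform_ge0 //.
by case Bj: (B j); rewrite ?bs // mulr_ge0.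
Qed.

Lemma test_achieve (b : R) :
  0 <= b -> \sum_i p i = 1 -> (forall j, B j -> s j <= b) ->
  exists T : 'M[C]_N, [/\ psdmx T, psdmx (1%:M - T),
    complex.Re (\tr (T *m sigma)) <= b * #|A|%:R &
    1 - \sum_(j | ~~ B j) w j - \sum_(i | ~~ A i) p i <=
      complex.Re (\tr (T *m rho))].
Proof.
move=> b0 p1 sb.
(* The rows of this matrix are the [e_i F] with [i] in [A], so the trace of [T] is at most
   [#|A|]. *)
have [T [Ta TT TK KT trT]] :=
  row_space_projector (rowsub (@enum_val _ A) P *m F).
have TF' : T *m F = T by have /submxP[X ->] := TK; rewrite -!mulmxA FF.
(* The rows of [T] lie in the range of [F], so [T F = T]; taking adjoints gives [F T = T]. Hence [T]
   vanishes at the eigenvectors of [sigma] outside [B]. *)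
have TF : F *m T *m F^t* = T.
  by rewrite Fadj -mulmxA TF' -[T in LHS]Ta -[F in LHS]Fadj -trmxC_mul TF' Ta.
have T0 : psdmx T by apply: adj_proj_psd.
have T1 : psdmx (1%:M - T).
  apply: adj_proj_psd.
    by rewrite trmxCB trmx1 map_mx1 Ta.
  by rewrite mulmxBl !mulmxBr !mulmx1 mul1mx TT subrr subr0.
exists T; split => //.
- apply: le_trans (ler_wpM2l b0 trT).
  rewrite -(sum_qform_unitary T uQ).
  rewrite trace_spectral mulr_sumr; apply: ler_sum => j _.
  case Bj: (B j); first by rewrite ler_wpM2r ?sb ?qform_ge0.
  have -> : qform T (row j Q) = 0.
    by rewrite -TF -qform_mul row_mul_spectral // Bj scale0r /qform !mul0mx mxE.
  by rewrite !mulr0.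
rewrite trace_spectral.
(* For [i] in [A], [T] fixes [e_i F], so replacing [F] by [T] loses nothing there; for other [i] the
   loss is at most [p i], because [F <= 1]. *)
have FT i : A i -> qform T (row i P) = qform F (row i P).
  move=> Ai.
  have : row i P *m F *m T = row i P *m F.
    have -> : row i P *m F = 
      row (enum_rank_in Ai i) (rowsub (@enum_val _ A) P *m F).
      by rewrite row_mul row_rowsub enum_rankK_in.
    by rewrite -row_mul KT.
  move=> h; rewrite -TF -qform_mul -[in RHS]F_sandwich -[RHS]qform_mul.
  by rewrite /qform h mulmx1.
have FB : \sum_i p i * qform F (row i P) = 1 - \sum_(j | ~~ B j) w j.
  apply/eqP; rewrite eq_sym subr_eq -(trace_spectral_proj (fun j => ~~ B j)).
  rewrite -big_split /=.
  rewrite -[X in X == _]p1; apply/eqP; apply: eq_bigr => i _.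
  rewrite -mulrDr /= spectral_compl.
  by rewrite -qform_addmx addrC subrK qform1_row ?mulr1.
rewrite -FB [X in _ - X]big_mkcond -sumrB; apply: ler_sum => i _.
case Ai: (A i) => /=; first by rewrite subr0 FT.
rewrite lerBlDr ler_wpDl //; first by rewrite mulr_ge0 // qform_ge0.
have Fle1 : qform F (row i P) <= 1.
  rewrite -[leRHS](qform1_row i uP) -subr_ge0 -qform_submx -spectral_compl.
  exact/qform_ge0/psd_proj_spectral.
by rewrite ler_piMr.
Qed.

End Tests.
End QuadraticForm.

(** * Tensor powers of spectral decompositions *)

Lemma ntensmx_mul (K : comPzRingType) m n p
    (A : 'M[K]_(m, n)) (B : 'M[K]_(n, p)) k :
  ntensmx (A *m B) k.+1 = ntensmx A k.+1 *m ntensmx B k.+1.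
Proof. by elim: k => [|k IH] //; rewrite !ntensmxSS IH tensmx_mul. Qed.

Lemma ntensmx_adj (K : numClosedFieldType) m n (A : 'M[K]_(m, n)) k :
  ntensmx (A^t*) k.+1 = (ntensmx A k.+1)^t*.
Proof.
elim: k => [|k IH] //; rewrite !ntensmxSS IH.
by apply/matrixP => i j; rewrite !mxE rmorphM.
Qed.

Lemma tensmx1 (K : comPzRingType) m n : (1%:M : 'M[K]_m) *t (1%:M : 'M[K]_n) = 1%:M.
Proof.
apply/matrixP => i j; rewrite !mxE -natrM mulnb; congr (nat_of_bool _)%:R.
rewrite -xpair_eqE -!surjective_pairing.
exact: inj_eq (can_inj (@mxtens_unindexK m n)) _ _.
Qed.

Lemma ntensmx_1 (K : comPzRingType) m k : ntensmx (1%:M : 'M[K]_m) k.+1 = 1%:M.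
Proof. by elim: k => [|k IH] //; rewrite ntensmxSS IH tensmx1. Qed.

Lemma ntensmx_unitary (K : numClosedFieldType) n (P : 'M[K]_n) k :
  P \is unitarymx -> ntensmx P k.+1 \is unitarymx.
Proof.
move=> uP; apply/unitarymxP.
by rewrite -ntensmx_adj -ntensmx_mul (unitarymxP uP) ntensmx_1.
Qed.

Section SpectralTensor.
Variables (R : realType) (d : nat).
Local Notation C := R[i].

Lemma ntensmx_diag (u : 'I_d -> R) k :
  ntensmx (diag_mx (\row_i (u i)%:C)) k.+1 =
  diag_mx (\row_i (@tens_prod R d u k i)%:C).
Proof.
elim: k => [|k IH] //; rewrite ntensmxSS IH.
have tens_prodS i : @tens_prod R d u k.+1 i =
  u (mxtens_unindex i).1 * tens_prod u (mxtens_unindex i).2 by [].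
apply/matrixP => i j; rewrite !mxE tens_prodS rmorphM mulrnAl mulrnAr -mulrnA mulnb.
congr (_ *+ nat_of_bool _).
rewrite andbC -xpair_eqE -!surjective_pairing.
exact: inj_eq (can_inj (@mxtens_unindexK _ _)) _ _.
Qed.

Lemma ntensmx_spectral (P : 'M[C]_d) (p : 'I_d -> R) k :
  ntensmx (spectral_mx P p) k.+1 =
  spectral_mx (ntensmx P k.+1) (@tens_prod R d p k).
Proof. by rewrite !spectral_mx.unlock !ntensmx_mul ntensmx_diag ntensmx_adj. Qed.

Lemma ntensmx_diagE (W : 'M[C]_d) (w : 'I_d -> R) k j :
  (forall i, W i i = (w i)%:C) -> ntensmx W k.+1 j j = (@tens_prod R d w k j)%:C.
Proof.
move=> Ww; elim: k j => [|k IH] j; first exact: Ww.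
by rewrite ntensmxSS mxE Ww IH /= rmorphM.
Qed.

Lemma qform_row N (A P : 'M[C]_N) i :
  qform A (row i P) = complex.Re ((P *m A *m P^t*) i i).
Proof.
rewrite /qform -row_mul; congr complex.Re; rewrite !mxE.
by apply: eq_bigr => k _; rewrite !mxE.
Qed.

(** Diagonal entries of a Kronecker power are products of diagonal entries. So a tensor power of
    [rho], seen in the product eigenbasis of [sigma], has a product distribution, to which
    Chebyshev's inequality applies. *)
Lemma qform_ntensmx (A P : 'M[C]_d) k j : A^t* = A ->
  qform (ntensmx A k.+1) (row j (ntensmx P k.+1)) =
  @tens_prod R d (fun i => qform A (row i P)) k j.
Proof.
move=> Aa; rewrite qform_row -ntensmx_adj -!ntensmx_mul.
rewrite (@ntensmx_diagE _ (fun i => qform A (row i P))) // => i.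
rewrite qform_row.
(* A diagonal entry of a Hermitian matrix is real, so taking [complex.Re] loses nothing. *)
have : ((P *m A *m P^t*) i i)^* = (P *m A *m P^t*) i i.
  have {2}-> : P *m A *m P^t* = (P *m A *m P^t*)^t*.
    by rewrite !trmxC_mul trmxCK Aa mulmxA.
  by rewrite !mxE.
case: (_ i i) => a b [/eqP]; rewrite eq_sym -subr_eq0 opprK -mulr2n mulrn_eq0 /=.
by move=> /eqP ->.
Qed.

Lemma qform_row_spectral N (P : 'M[C]_N) p i : P \is unitarymx ->
  qform (spectral_mx P p) (row i P) = p i.
Proof.
move=> uP; rewrite /qform row_mul_spectral // -scalemxAl mxE.
have := qform1_row i uP; rewrite /qform mulmx1.
by case: (_ 0 0) => a b /= ->; rewrite mulr1 mul0r subr0.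
Qed.

Definition spec (A : 'M[C]_d) (i : 'I_d) : R := complex.Re (spectral_diag A 0 i).

Lemma spectral_mx_invmx N (P : 'M[C]_N) (v : 'rV[C]_N) (p : 'I_N -> R) :
  P \is unitarymx -> v = \row_i (p i)%:C ->
  invmx P *m diag_mx v *m P = spectral_mx P p.
Proof. by move=> uP ->; rewrite (invmx_unitary uP) spectral_mx.unlock. Qed.

Lemma hermfun_spectral (f : R -> R) (A : 'M[C]_d) :
  hermfun f A = spectral_mx (spectralmx A) (f \o spec A).
Proof.
apply: (spectral_mx_invmx (spectral_unitarymx A)).
by apply/rowP => i; rewrite !mxE.
Qed.

Lemma hermitian_spectralE (A : 'M[C]_d) : A \is hermsymmx ->
  A = spectral_mx (spectralmx A) (spec A).
Proof.
move=> hA; have /orthomx_spectralP AE := hermitian_normalmx hA.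
rewrite [LHS]AE; apply: (spectral_mx_invmx (spectral_unitarymx A)).
apply/rowP => i; rewrite mxE /spec.
by have /mxOverP /(_ 0 i) /RRe_real := hermitian_spectral_diag_real hA.
Qed.

Section Psd.
Variable A : 'M[C]_d.
Hypothesis A0 : psdmx A.

Lemma psdmx_adj : A^t* = A.
Proof. by case: A0 => /is_hermitianmxP; rewrite expr0 scale1r. Qed.

Lemma spec_ge0 i : 0 <= spec A i.
Proof.
rewrite -(qform_row_spectral (spec A) i (spectral_unitarymx A)).
by rewrite -hermitian_spectralE ?qform_ge0 //; case: A0.
Qed.

Lemma spec_gt0 i : A \in unitmx -> 0 < spec A i.
Proof.
move=> uA; rewrite lt_neqAle spec_ge0 andbT; apply/eqP => s0.
have uP := spectral_unitarymx A.
have := row_mul_spectral (spec A) i uP.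
rewrite -hermitian_spectralE; last by case: A0.
rewrite -s0 scale0r => /(congr1 (mulmx^~ (invmx A))).
rewrite mulmxK // mul0mx => r0.
have := qform1_row i uP; rewrite r0 /qform !mul0mx mxE /= => /eqP.
by rewrite eq_sym oner_eq0.
Qed.

Lemma sum_spec : complex.Re (\tr A) = \sum_i spec A i.
Proof.
have := trace_spectral 1%:M (spectralmx A) (spec A).
rewrite mul1mx -hermitian_spectralE => [->|]; last by case: A0.
by apply: eq_bigr => i _; rewrite qform1_row ?spectral_unitarymx ?mulr1.
Qed.

End Psd.

(** Each trace is expanded in the eigenbasis of its logarithm; the second one sees only the diagonal
    of [rho] in the eigenbasis of [sigma]. *)
Lemma qrelentE (rho sigma : 'M[C]_d) : psdmx rho ->
  qrelent rho sigma = \sum_i spec rho i * ln (spec rho i)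
   - \sum_j qform rho (row j (spectralmx sigma)) * ln (spec sigma j).
Proof.
move=> r0; rewrite /qrelent /logmx !hermfun_spectral mulmxBr !raddfB /=.
rewrite !trace_spectral; congr (_ - _); apply: eq_bigr => i _ /=; last exact: mulrC.
have := qform_row_spectral (spec rho) i (spectral_unitarymx rho).
by rewrite -(hermitian_spectralE (proj1 r0)) mulrC => ->.
Qed.

End SpectralTensor.

(** * Information-spectrum divergence rates *)

Section DivergenceRates.
Variables (R : realType) (Omega : nat -> finType).
Variables p q : forall n, Omega n -> R.
Hypotheses (p_ge0 : forall n w, 0 <= @p n w) (q_ge0 : forall n w, 0 <= @q n w).

(** If [p w = 0], the ratio is [-oo] and the premise fails; if [q w = 0], the left side of the
    conclusion is 0. *)
Lemma llr_gt n (w : Omega n) l :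
  (l%:E < llr p q w)%E -> q w * expR (n.+1%:R * l) <= p w.
Proof.
rewrite /llr; have n0 : 0 < n.+1%:R^-1 :> R by rewrite invr_gt0 ltr0n.
have [p0|p0] := eqVneq (p w) 0.
  by rewrite p0 mul0e le0_lneNy // gt0_muleNy ?lte_fin.
have {}p0 : 0 < p w by rewrite lt_neqAle eq_sym p0 p_ge0.
have [->|q0] := eqVneq (q w) 0; first by rewrite mul0r p_ge0.
have q0' : 0 < q w by rewrite lt_neqAle eq_sym q0 q_ge0.
rewrite inver (negbTE q0) -EFinM lne_EFin ?divr_gt0 // -EFinM lte_fin.
rewrite ltr_pdivlMl ?ltr0n // => h.
rewrite mulrC -ler_pdivlMr // -[leRHS]lnK ?posrE ?divr_gt0 //.
by rewrite ler_expR ltW.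
Qed.

Lemma llr_ge n (w : Omega n) l :
  0 < p w -> q w * expR (n.+1%:R * l) <= p w -> (l%:E <= llr p q w)%E.
Proof.
rewrite /llr => p0 h; have n0 : 0 < n.+1%:R^-1 :> R by rewrite invr_gt0 ltr0n.
have [->|q0] := eqVneq (q w) 0.
  by rewrite inve0 gt0_muley ?lte_fin //= gt0_muley ?lte_fin ?leey.
have q0' : 0 < q w by rewrite lt_neqAle eq_sym q0 q_ge0.
rewrite inver (negbTE q0) -EFinM lne_EFin ?divr_gt0 // -EFinM lee_fin.
rewrite ler_pdivlMl ?ltr0n //.
have {}h : expR (n.+1%:R * l) <= p w / q w by rewrite ler_pdivlMr // mulrC.
by rewrite -[leLHS]expRK ler_ln ?posrE ?expR_gt0 ?divr_gt0.
Qed.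

(** If [l' < l] with both tails vanishing, then for some [n] each tail has mass below 1/2, although
    the two events cover all outcomes. *)
Lemma inf_div_rate_le_sup : (forall n, \sum_w @p n w = 1) ->
  (inf_div_rate p q <= sup_div_rate p q)%E.
Proof.
move=> p1; apply: ge_ereal_sup => _ [l /= hl <-].
apply: le_ereal_inf_tmp => _ [l' /= hl' <-].
rewrite lee_fin leNgt; apply/negP => ll'.
have h2 : 0 < 2^-1 :> R by rewrite invr_gt0.
have [n [n1 n2]] : exists n,
    \sum_(w : Omega n | (llr p q w < l%:E)%E) p w < 2^-1 /\
    \sum_(w : Omega n | (l'%:E < llr p q w)%E) p w < 2^-1.
  near \oo => n; exists n; split; near: n.
  - exact: (cvgr_lt _ hl).
  - exact: (cvgr_lt _ hl').
have : \sum_w @p n w <= \sum_(w : Omega n | (llr p q w < l%:E)%E) p w +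
    \sum_(w : Omega n | (l'%:E < llr p q w)%E) p w.
  rewrite ![X in X + _]big_mkcond [X in _ + X]big_mkcond -big_split /=.
  apply: ler_sum => w _.
  case: ltP => [_|h1]; first by rewrite lerDl; case: ifP.
  by rewrite (lt_le_trans _ h1) ?lte_fin // add0r.
rewrite p1; lra.
Unshelve. all: by end_near.
Qed.

End DivergenceRates.

Lemma cvg_expRN (R : realType) (e : R) : 0 < e ->
  (fun n => expR (- (n.+1%:R * e))) @ \oo --> (0 : R).
Proof.
move=> e0.
have /cvg_expr : `|expR (- e)| < 1.
  by rewrite ger0_norm ?expR_ge0 // expR_lt1 oppr_lt0.
rewrite -cvg_shiftS; apply: cvg_trans; apply: near_eq_cvg; near=> n.
by rewrite /= -mulrN expRM_natl.
Unshelve. all: by end_near.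
Qed.

(** * Sums of positive semidefinite matrices and POVM elements *)

Section PsdSums.
Variables (R : realType) (N : nat).
Local Notation C := R[i].

Lemma psdmxD (S T : 'M[C]_N) : psdmx S -> psdmx T -> psdmx (S + T).
Proof.
move=> [hS S0] [hT T0]; split.
  apply/is_hermitianmxP; rewrite expr0 scale1r.
  rewrite [in LHS](is_hermitianmxP _ _ _ hS) [in LHS](is_hermitianmxP _ _ _ hT).
  by rewrite !expr0 !scale1r; apply/matrixP => i j; rewrite !mxE rmorphD.
by move=> x; rewrite mulmxDr mulmxDl mxE addr_ge0 ?S0 ?T0.
Qed.

Lemma psdmx_sum (I : finType) (c : pred I) (F : I -> 'M[C]_N) :
  (forall i, psdmx (F i)) -> psdmx (\sum_(i | c i) F i).
Proof.
move=> F0; apply: (big_ind (@psdmx R N)); [|exact: psdmxD|by move=> i _; exact: F0].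
split; last by move=> x; rewrite mulmx0 mul0mx mxE lexx.
by apply/is_hermitianmxP; rewrite trmx0 map_mx0 scaler0.
Qed.

Lemma povm_prob_ge0 (M : povm R N) (P : 'M[C]_N) p k :
  (forall i, 0 <= p i) -> 0 <= @povm_prob R N M (spectral_mx P p) k.
Proof.
move=> p0; rewrite /povm_prob trace_spectral; apply: sumr_ge0 => i _.
by rewrite mulr_ge0 // qform_ge0 //; exact: povm_psd.
Qed.

Lemma sum_povm_prob (M : povm R N) (A : 'M[C]_N) (c : pred 'I_(outcomes M)) :
  \sum_(k | c k) @povm_prob R N M A k =
  complex.Re (\tr ((\sum_(k | c k) povm_op k) *m A)).
Proof. by rewrite mulmx_suml (raddf_sum (@mxtrace _ N)) raddf_sum. Qed.

Lemma povm_psd_compl (M : povm R N) (c : pred 'I_(outcomes M)) :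
  psdmx (1%:M - \sum_(k | c k) povm_op k).
Proof.
suff -> : 1%:M - \sum_(k | c k) povm_op k = \sum_(k | ~~ c k) povm_op k.
  exact/psdmx_sum/povm_psd.
by apply/eqP; rewrite subr_eq -(povm_sum M) (bigID c) /= addrC.
Qed.

Section BinaryPovm.
Variable T : 'M[C]_N.
Hypotheses (T0 : psdmx T) (T1 : psdmx (1%:M - T)).

Let op (k : 'I_2) := if k == ord0 then T else 1%:M - T.

Let op_psd k : psdmx (op k). Proof. by rewrite /op; case: ifP. Qed.

Let op_sum : \sum_k op k = 1%:M.
Proof. by rewrite big_ord_recl big_ord1 /op /= addrC subrK. Qed.

Definition binary_povm : povm R N := Povm op_psd op_sum.

End BinaryPovm.
End PsdSums.

(** * Bounds on both divergence rates for tensor powers *)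

Section SteinLemma.
Variables (R : realType) (d : nat) (rho sigma : 'M[R[i]]_d).
Hypotheses (hrho : density rho) (hsigma : density sigma).
Hypothesis (hinv : sigma \in unitmx).

Local Notation P := (spectralmx rho).
Local Notation Q := (spectralmx sigma).
Local Notation p := (spec rho).
Local Notation s := (spec sigma).
(** [w] is the distribution of [rho] measured in the eigenbasis of [sigma]; [m1] and [m2] are the
    means around which the normalized log-eigenvalues concentrate. *)
Let w j := qform rho (row j Q).
Let m1 := \sum_i p i * ln (p i).
Let m2 := \sum_j w j * ln (s j).
Local Notation D := (qrelent rho sigma).

Let rho0 : psdmx rho. Proof. by case: hrho. Qed.
Let sigma0 : psdmx sigma. Proof. by case: hsigma. Qed.
Let p0 i : 0 <= p i. Proof. exact: spec_ge0. Qed.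
Let s0 i : 0 <= s i. Proof. exact: spec_ge0. Qed.
Let w0 i : 0 <= w i. Proof. exact: qform_ge0. Qed.
Let p1 : \sum_i p i = 1.
Proof. by rewrite -sum_spec //; case: hrho => _ ->. Qed.
Let w1 : \sum_i w i = 1.
Proof. by rewrite sum_qform_unitary ?spectral_unitarymx //; case: hrho => _ ->. Qed.
Let DE : D = m1 - m2. Proof. exact: qrelentE. Qed.

Let rhoE n : ntensmx rho n.+1 = spectral_mx (ntensmx P n.+1) (@tens_prod R d p n).
Proof. by rewrite -ntensmx_spectral -hermitian_spectralE //; case: rho0. Qed.
Let sigmaE n :
  ntensmx sigma n.+1 = spectral_mx (ntensmx Q n.+1) (@tens_prod R d s n).
Proof. by rewrite -ntensmx_spectral -hermitian_spectralE //; case: sigma0. Qed.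

Definition rho_atypical dl n :=
  \sum_(k | ~~ @typical R d p m1 dl n k) tens_prod p k.
Definition sigma_atypical dl n :=
  \sum_(k | ~~ @typical R d s m2 dl n k) tens_prod w k.

Lemma atypical_cvg dl : 0 < dl ->
  (fun n => rho_atypical dl n + sigma_atypical dl n) @ \oo --> (0 : R).
Proof.
move=> dl0; rewrite -[X in _ --> X](addr0 0); apply: cvgD.
  exact: typical_set_cvg.
(* Invertibility of [sigma] makes all its eigenvalues positive, which is the support condition
   here. *)
by apply: typical_set_cvg => // i _; exact: spec_gt0.
Qed.

Let sigma_atypicalE dl n :
  \sum_(j | ~~ @typical R d s m2 dl n j)
    qform (spectral_mx (ntensmx P n.+1) (@tens_prod R d p n))
      (row j (ntensmx Q n.+1))
  = sigma_atypical dl n.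
Proof.
apply: eq_bigr => j _; rewrite -rhoE qform_ntensmx //; exact: psdmx_adj.
Qed.

Lemma iid_test_converse dl n (T : 'M[R[i]]_(d ^ n.+1)) :
  psdmx T -> psdmx (1%:M - T) ->
  complex.Re (\tr (T *m ntensmx rho n.+1)) <=
  rho_atypical dl n + 2 * (expR (n.+1%:R * (D + 2 * dl)) *
    complex.Re (\tr (T *m ntensmx sigma n.+1))) + 2 * sigma_atypical dl n.
Proof.
move=> T0 T1.
(* The factors serve as [a], the largest typical eigenvalue of [rho], and [b], the inverse of the
   smallest typical eigenvalue of [sigma]. *)
have -> : expR (n.+1%:R * (D + 2 * dl)) =
    expR (n.+1%:R * (m1 + dl)) * expR (- (n.+1%:R * (m2 - dl))).
  by rewrite -expRD; congr expR; rewrite DE; ring.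
rewrite rhoE sigmaE -sigma_atypicalE.
apply: test_converse => //; rewrite ?expR_ge0 //.
- exact/ntensmx_unitary/spectral_unitarymx.
- exact/ntensmx_unitary/spectral_unitarymx.
- by move=> i; apply: tens_prod_ge0.
- by move=> i; apply: tens_prod_ge0.
- by move=> i /andP[].
- by move=> j /andP[h _]; rewrite expRN mulrC ler_pdivlMr ?expR_gt0 // mul1r.
Qed.

Lemma iid_test_achieve dl n :
  exists T : 'M[R[i]]_(d ^ n.+1), [/\ psdmx T, psdmx (1%:M - T),
    complex.Re (\tr (T *m ntensmx sigma n.+1)) <=
      expR (- (n.+1%:R * (D - 2 * dl))) &
    1 - (rho_atypical dl n + sigma_atypical dl n) <=
      complex.Re (\tr (T *m ntensmx rho n.+1))].
Proof.
have [] := @test_achieve R (d ^ n.+1) (ntensmx P n.+1) (ntensmx Q n.+1)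
  (@tens_prod R d p n) (@tens_prod R d s n)
  (@typical R d p m1 dl n) (@typical R d s m2 dl n)
  _ _ _ (expR (n.+1%:R * (m2 + dl))).
- exact/ntensmx_unitary/spectral_unitarymx.
- exact/ntensmx_unitary/spectral_unitarymx.
- by move=> i; apply: tens_prod_ge0.
- exact: expR_ge0.
- by rewrite sum_tens_prod p1 expr1n.
- by move=> j /andP[].
move=> T [T0 T1 Ts Tr]; exists T; split => //.
  rewrite sigmaE; apply: le_trans Ts _.
  (* The bound on typical eigenvalues of [sigma], times the bound on the number of typical
     eigenvectors of [rho]. *)
  have -> : expR (- (n.+1%:R * (D - 2 * dl))) =
    expR (n.+1%:R * (m2 + dl)) * expR (- (n.+1%:R * (m1 - dl))).
    by rewrite -expRD; congr expR; rewrite DE; ring.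
  by rewrite ler_pM2l ?expR_gt0 // card_typical.
by move: Tr; rewrite sigma_atypicalE rhoE opprD addrA addrAC.
Qed.

Let rn_ge0 (M : povm_seq R d) n k :
  0 <= @povm_prob R _ (M n) (ntensmx rho n.+1) k.
Proof. by rewrite rhoE; apply: povm_prob_ge0 => i; apply: tens_prod_ge0. Qed.

Let sn_ge0 (M : povm_seq R d) n k :
  0 <= @povm_prob R _ (M n) (ntensmx sigma n.+1) k.
Proof. by rewrite sigmaE; apply: povm_prob_ge0 => i; apply: tens_prod_ge0. Qed.

Let rn_tr1 n : complex.Re (\tr (ntensmx rho n.+1)) = 1.
Proof.
rewrite -(sum_qform_unitary _ (ntensmx_unitary n (spectral_unitarymx rho))).
rewrite -[RHS](expr1n R n.+1) -p1 -sum_tens_prod; apply: eq_bigr => i _.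
by rewrite rhoE qform_row_spectral // ntensmx_unitary ?spectral_unitarymx.
Qed.

Let rn_sum1 (M : povm_seq R d) n :
  \sum_k @povm_prob R _ (M n) (ntensmx rho n.+1) k = 1.
Proof. by rewrite sum_povm_prob povm_sum mul1mx rn_tr1. Qed.

Lemma povm_inf_le_sup M :
  (povm_inf_div_rate rho sigma M <= povm_sup_div_rate rho sigma M)%E.
Proof. by apply: inf_div_rate_le_sup. Qed.

Lemma povm_sup_div_rate_le M : (povm_sup_div_rate rho sigma M <= D%:E)%E.
Proof.
apply/lee_addgt0Pr => e e0; rewrite -EFinD.
apply: ereal_inf_lbound; exists (D + e) => //=.
set f := (X in X @ _).
have e4 : 0 < e / 4 by rewrite divr_gt0.
have e2 : 0 < e / 2 by rewrite divr_gt0.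
(* With [dl = e / 4] the prefactor has exponent [D + e / 2], and against the exponent [D + e] of the
   [sigma]-probability it leaves a decay at rate [e / 2]. *)
apply: (@squeeze_cvgr _ _ _ _ (fun=> 0) (fun n =>
  2 * (rho_atypical (e / 4) n + sigma_atypical (e / 4) n)
  + 2 * expR (- (n.+1%:R * (e / 2))))).
- near=> n; rewrite /f; apply/andP; split.
    by apply: sumr_ge0 => k _; apply: rn_ge0.
  pose c k := ((D + e)%:E < @llr R (fun n => 'I_(outcomes (M n)))
    (fun n => @povm_prob R _ (M n) (ntensmx rho n.+1))
    (fun n => @povm_prob R _ (M n) (ntensmx sigma n.+1)) n k)%E.
  rewrite -[leLHS]/(
    \sum_(k | c k) @povm_prob R _ (M n) (ntensmx rho n.+1) k).
  rewrite sum_povm_prob; set T := \sum_(k | _) _.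
  have T0 : psdmx T by apply: psdmx_sum; exact: povm_psd.
  have T1 : psdmx (1%:M - T) by exact: povm_psd_compl.
  (* Markov-type bound: on every selected outcome the [sigma]-probability is at most
     [expR (- (n.+1 * (D + e)))] times the [rho]-probability, and the latter sum to at most 1. *)
  have hs : complex.Re (\tr (T *m ntensmx sigma n.+1)) <=
      expR (- (n.+1%:R * (D + e))).
    rewrite -sum_povm_prob -[leRHS]mulr1 expRN ler_pdivlMl ?expR_gt0 //.
    rewrite -[leRHS](rn_sum1 M n) mulr_sumr [leRHS](bigID c) /=.
    apply: ler_wpDr; first by apply: sumr_ge0 => k _; apply: rn_ge0.
    apply: ler_sum => k ck; rewrite mulrC.
    exact: (llr_gt (@rn_ge0 M) (@sn_ge0 M) ck).
  have := iid_test_converse (e / 4) T0 T1.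
  have -> : expR (- (n.+1%:R * (e / 2))) =
    expR (n.+1%:R * (D + 2 * (e / 4))) * expR (- (n.+1%:R * (D + e))).
    by rewrite -expRD; congr expR; move: D => x; field.
  have := ler_wpM2l (expR_ge0 (n.+1%:R * (D + 2 * (e / 4)))) hs.
  have : 0 <= rho_atypical (e / 4) n.
    by apply: sumr_ge0 => k _; apply: tens_prod_ge0.
  lra.
- exact: cvg_cst.
- rewrite -[X in _ --> X](addr0 0); apply: cvgD.
    by rewrite -[X in _ --> X](mulr0 2); apply: cvgM;
      [exact: cvg_cst|exact: atypical_cvg].
  by rewrite -[X in _ --> X](mulr0 2); apply: cvgM;
    [exact: cvg_cst|exact: cvg_expRN].
Unshelve. all: by end_near.
Qed.

Lemma sum_ord2_le (c : pred 'I_2) (f : 'I_2 -> R) :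
  0 <= f (lift ord0 ord0) -> ~~ c ord0 ->
  \sum_(k | c k) f k <= f (lift ord0 ord0).
Proof.
move=> f0 c0; rewrite big_mkcond big_ord_recl big_ord1 /= (negbTE c0) add0r.
by case: ifP.
Qed.

(** For large [n] the accepting outcome has log-likelihood ratio at least [D - e], so only the
    rejecting outcome can fall below; its [rho]-probability is at most the vanishing atypical
    mass. *)
Lemma povm_inf_div_rate_ge e : 0 < e ->
  exists M : povm_seq R d, (D%:E - e%:E <= povm_inf_div_rate rho sigma M)%E.
Proof.
move=> e0; have e4 : 0 < e / 4 by rewrite divr_gt0.
have e2 : 0 < e / 2 by rewrite divr_gt0.
pose T n := sval (cid (iid_test_achieve (e / 4) n)).
have TP n := svalP (cid (iid_test_achieve (e / 4) n)).
have T0 n : psdmx (T n) by case: (TP n).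
have T1 n : psdmx (1%:M - T n) by case: (TP n).
pose M : povm_seq R d := fun n => binary_povm (T0 n) (T1 n).
exists M; rewrite -EFinB; apply: ereal_sup_ubound; exists (D - e) => //=.
set f := (X in X @ _).
apply: (@squeeze_cvgr _ _ _ _ (fun=> 0)
  (fun n => rho_atypical (e / 4) n + sigma_atypical (e / 4) n)).
- near=> n; rewrite /f; apply/andP; split.
    by apply: sumr_ge0 => k _; apply: rn_ge0.
  have [_ _ hs hr] := TP n; rewrite -/(T n) in hs hr.
  (* The value 1/2 separates the two sides: the accepting outcome has [rho]-probability at least
     1/2, while its [sigma]-probability times [expR (n.+1 * (D - e))] is at most
     [expR (- (n.+1 * (e / 2)))], eventually below 1/2. *)
  have t2 : rho_atypical (e / 4) n + sigma_atypical (e / 4) n < 2^-1.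
    near: n; apply: (cvgr_lt _ (atypical_cvg e4)); by rewrite invr_gt0.
  have x2 : expR (- (n.+1%:R * (e / 2))) < 2^-1.
    near: n; apply: (cvgr_lt _ (cvg_expRN e2)); by rewrite invr_gt0.
  pose k0 : 'I_(outcomes (M n)) := (ord0 : 'I_2).
  have r0 : 2^-1 <= @povm_prob R _ (M n) (ntensmx rho n.+1) k0.
    by rewrite /povm_prob /=; move: hr; lra.
  have c0 : ~~ (@llr R (fun n => 'I_(outcomes (M n)))
      (fun n => @povm_prob R _ (M n) (ntensmx rho n.+1))
      (fun n => @povm_prob R _ (M n) (ntensmx sigma n.+1)) n k0 < (D - e)%:E)%E.
    rewrite -leNgt; apply: llr_ge; first exact: sn_ge0.
      by apply: lt_le_trans r0; rewrite invr_gt0.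
    apply: le_trans r0; apply: le_trans (ltW x2).
    apply: le_trans (ler_wpM2r (expR_ge0 _) hs) _.
    rewrite -expRD ler_expR; move: D => x.
    by rewrite le_eqVlt; apply/orP; left; apply/eqP; field.
  apply: le_trans (@sum_ord2_le _ _ _ c0) _; first exact: rn_ge0.
  rewrite /povm_prob /= mulmxBl mul1mx !raddfB /= rn_tr1; move: hr; lra.
- exact: cvg_cst.
- exact: atypical_cvg.
Unshelve. all: by end_near.
Qed.

End SteinLemma.

Theorem mainTheorem2 (R : realType) (d : nat) (rho sigma : 'M[R[i]]_d)
  (hrho : density rho) (hsigma : density sigma) (hinv : sigma \in unitmx) :
  ereal_sup [set povm_inf_div_rate rho sigma M | M in [set: povm_seq R d]]
    = ereal_sup [set povm_sup_div_rate rho sigma M | M in [set: povm_seq R d]]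
  /\ ereal_sup [set povm_sup_div_rate rho sigma M | M in [set: povm_seq R d]]
    = (qrelent rho sigma)%:E.
Proof.
(* The cycle [I <= S <= D <= I] gives both equalities. *)
set I := ereal_sup _; set S := ereal_sup _.
have IS : (I <= S)%E.
  apply: ge_ereal_sup => _ [M _ <-].
  apply: (@le_trans _ _ (povm_sup_div_rate rho sigma M)).
    exact: povm_inf_le_sup.
  by apply: ereal_sup_ubound; exists M.
have SD : (S <= (qrelent rho sigma)%:E)%E.
  by apply: ge_ereal_sup => _ [M _ <-]; exact: povm_sup_div_rate_le.
have DI : ((qrelent rho sigma)%:E <= I)%E.
  apply/lee_subgt0Pr => e e0.
  have [M hM] := povm_inf_div_rate_ge hrho hsigma hinv e0.
  by apply: le_trans hM _; apply: ereal_sup_ubound; exists M.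
split; apply/eqP; rewrite eq_le.
  by rewrite IS (le_trans SD DI).
by rewrite SD (le_trans DI IS).
Qed.
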